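(* Let $\mathcal{I}$ be a nontrivial admissible ideal of subsets of $\mathbb{N}$ and let $H\subset\mathbb{R}$ be a Lebesgue measurable set. For every $\mathfrak{T}_U$-closed set $Z$ such that $Z\subset H$ and $\mathcal{I}\text{-}d(x,H)=1$ for all $x\in Z$, there exists a $\mathfrak{T}_U$-perfect set $P$ such that $Z\subset P\subset H$ and $\mathcal{I}\text{-}d(x,P)=1$ for all $x\in Z$.
   Context: $m$ denotes Lebesgue measure on $\mathbb{R}$ and $\mathfrak{T}_U$ the usual topology of $\mathbb{R}$. A set is $\mathfrak{T}_U$-perfect if it is $\mathfrak{T}_U$-closed and has no isolated points in its relative topology (the empty set is allowed). An ideal $\mathcal{I}$ of subsets of $\mathbb{N}=\{1,2,\dots\}$ is a nonempty family closed under finite unions and under subsets; it is nontrivial if $\mathcal{I}\neq\{\emptyset\}$ and $\mathbb{N}\notin\mathcal{I}$, and admissible if it contains all singletons. $\mathcal{F}(\mathcal{I})=\{M\subset\mathbb{N}:\mathbb{N}\setminus M\in\mathcal{I}\}$. For a bounded real sequence $x=(x_n)$: $\mathcal{I}\text{-}\limsup x=\sup\{b\in\mathbb{R}:\{k:x_k>b\}\notin\mathcal{I}\}$ and $\mathcal{I}\text{-}\liminf x=\inf\{a\in\mathbb{R}:\{k:x_k<a\}\notin\mathcal{I}\}$. Let $E\subset\mathbb{R}$ be Lebesgue measurable and $p\in\mathbb{R}$. Consider sequences $(J_n)_{n\in\mathbb{N}}$ of closed intervals with $p\in J_n$ for all $n$ and $\{n\in\mathbb{N}:0<m(J_n)<\frac1n\}\in\mathcal{F}(\mathcal{I})$.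 For such a sequence put $x_n=\frac{m(J_n\cap E)}{m(J_n)}$ (with $x_n:=0$ if $m(J_n)\in\{0,\infty\}$; such $n$ form a set in $\mathcal{I}$ and do not matter). The upper $\mathcal{I}$-density $\mathcal{I}\text{-}d^-(p,E)$ is the supremum of $\mathcal{I}\text{-}\limsup x_n$ over all such sequences $(J_n)$, and the lower $\mathcal{I}$-density $\mathcal{I}\text{-}d_-(p,E)$ is the infimum of $\mathcal{I}\text{-}\liminf x_n$ over all such sequences. If they are equal, the common value is the $\mathcal{I}$-density $\mathcal{I}\text{-}d(p,E)$; ''$\mathcal{I}\text{-}d(p,E)=1$'' means it exists and equals $1$. *)

(* Defs.v *)
From mathcomp Require Import all_boot all_order all_algebra.
From mathcomp Require Import all_classical all_reals all_analysis.
Set Implicit Arguments.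
Unset Strict Implicit.
Unset Printing Implicit Defensive.
Import Order.TTheory GRing.Theory Num.Theory.
Import numFieldNormedType.Exports.
Local Open Scope classical_set_scope.
Local Open Scope ring_scope.

(* The index set {1, 2, 3, ...}: sequences and ideals do not involve 0. *)
Definition posnat : Type := {n : nat | (0 < n)%N}.

Definition is_ideal (T : Type) (I : set (set T)) : Prop :=
  [/\ I !=set0,
      forall A B : set T, I A -> I B -> I (A `|` B)
    & forall A B : set T, A `<=` B -> I B -> I A].

Definition nontrivial_ideal (T : Type) (I : set (set T)) : Prop :=
  I <> [set set0] /\ ~ I setT.

Definition admissible_ideal (T : Type) (I : set (set T)) : Prop :=
  forall n : T, I [set n].

Definition dual_filter (T : Type) (I : set (set T)) : set (set T) :=
  [set M | I (~` M)].

(* Suprema and infima are taken in \bar R, which avoids the default values of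
   the real-valued sup and inf on empty or unbounded sets. *)
Definition ideal_limsup (R : realType) (I : set (set posnat))
    (x : posnat -> R) : \bar R :=
  ereal_sup [set b%:E | b in [set b : R | ~ I [set k | b < x k]]].

Definition ideal_liminf (R : realType) (I : set (set posnat))
    (x : posnat -> R) : \bar R :=
  ereal_inf [set a%:E | a in [set a : R | ~ I [set k | x k < a]]].

(* measurable on R is Borel measurability; Lebesgue measurable sets are the
   Caratheodory-measurable sets of the Lebesgue outer measure, i.e. the
   domain of completed_lebesgue_measure. *)
Definition lebesgue_measurable (R : realType) (E : set R) : Prop :=
  (wlength (@idfun R))^*%mu.-cara.-measurable E.

(* Degenerate and unbounded closed intervals are allowed. *)
Definition closed_interval (R : realType) (J : set R) : Prop :=
  is_interval J /\ closed J.

Definition ideal_shrinking (R : realType) (I : set (set posnat)) (p : R)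
    (J : posnat -> set R) : Prop :=
  [/\ forall n, closed_interval (J n),
      forall n, J n p
    & dual_filter I
        [set n | (0 < completed_lebesgue_measure (J n)
                    < ((val n)%:R^-1 : R)%:E)%E]].

(* Since fine +oo = 0 and r / 0 = 0, this is 0 whenever m(J n) is 0 or +oo. *)
Definition relative_measure (R : realType) (E : set R) (J : posnat -> set R)
    (n : posnat) : R :=
  fine (completed_lebesgue_measure (J n `&` E))
    / fine (completed_lebesgue_measure (J n)).

Definition upper_ideal_density (R : realType) (I : set (set posnat)) (p : R)
    (E : set R) : \bar R :=
  ereal_sup [set ideal_limsup I (relative_measure E J)
            | J in [set J | ideal_shrinking I p J]].

Definition lower_ideal_density (R : realType) (I : set (set posnat)) (p : R)
    (E : set R) : \bar R :=
  ereal_inf [set ideal_liminf I (relative_measure E J)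
            | J in [set J | ideal_shrinking I p J]].

(* The density of E at p exists and equals d. *)
Definition has_ideal_density (R : realType) (I : set (set posnat)) (p : R)
    (E : set R) (d : R) : Prop :=
  upper_ideal_density I p E = d%:E /\ lower_ideal_density I p E = d%:E.

(* Main.v *)
Require Import Defs.
From mathcomp Require Import all_boot all_order all_algebra.
From mathcomp Require Import all_classical all_reals all_analysis.
From mathcomp Require Import measurable_realfun lra.
Import Order.TTheory GRing.Theory Num.Theory.
Import numFieldNormedType.Exports.
Local Open Scope classical_set_scope.
Local Open Scope ring_scope.

(** The density in the sense of the ideal has value 1 at p exactly when the
    ordinary Lebesgue density at p is 1 ([has_ideal_density_one]).  The lower
    density is an infimum over ALL shrinking sequences of intervals, so if
    arbitrarily short intervals around p have relative measure below 1 - e, one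
    may choose such an interval shorter than 1/n for every n, and the resulting
    lower limit is at most 1 - e whatever the ideal is.  Conversely, ordinary
    density 1 controls every interval of length below some d, and the indices n
    with 1/n >= d are finitely many, hence negligible for an admissible ideal.

    It remains to find a perfect P between Z and H that keeps ordinary density 1
    on Z.  First a closed F is obtained ([closed_subset_quadratic_loss]) by
    removing from the line an open set that covers the complement of H, avoids Z
    and has so little excess over that complement near Z that an interval J
    meeting Z loses at most |J|^2 of its intersection with H; the loss is
    negligible with respect to |J|, so the density survives
    ([density_one_perturb]).  Then F is replaced by the support P of Lebesgue
    measure restricted to F ([measure_support]).  This changes no measure; P has
    no isolated point, because a neighbourhood of a point of P meets P in a set
    of positive measure while singletons are null; and Z stays inside P, because
    a closed set contains its points of density 1 ([density_one_closed]). *)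

(** * Outer measure of intervals *)

(* The completed Lebesgue measure and the Lebesgue measure are both, by
   conversion, restrictions of this outer measure, which gives monotonicity and
   subadditivity without any measurability condition. *)
Local Notation mu := (wlength idfun)^*%mu.

Lemma fin_num_mu (R : realType) (A B : set R) (r : R) :
  A `<=` B -> (mu B < r%:E)%E -> mu A \is a fin_num.
Proof.
move=> AB Br; rewrite ge0_fin_numE ?outer_measure_ge0//.
apply: le_lt_trans (lt_trans Br (ltry _)); exact: le_outer_measure.
Qed.

Lemma mu_itvcc (R : realType) (a b : R) : a <= b -> mu `[a, b] = (b - a)%:E.
Proof.
move=> ab; rewrite -[LHS]/(lebesgue_measure `[a, b]) lebesgue_measure_itv /=.
rewrite lte_fin; move: ab; rewrite le_eqVlt => /predU1P[->|ab].
  by rewrite ltxx subrr.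
by rewrite ab EFinB.
Qed.

Lemma interval_dist_le_mu (R : realType) (J : set R) (x y : R) :
  is_interval J -> J x -> J y -> (`|x - y|%:E <= mu J)%E.
Proof.
move=> Jint; wlog xy : x y / x <= y.
  by move=> hw Jx Jy; case: (leP x y) => [|/ltW] xy; [|rewrite distrC]; exact: hw.
move=> Jx Jy.
rewrite distrC ger0_norm ?subr_ge0// -mu_itvcc//.
apply: le_outer_measure => z /=; rewrite in_itv /= => xzy.
exact: (Jint _ _ Jx Jy).
Qed.

(** * Ideal density one is ordinary density one *)

(** Ordinary Lebesgue density 1, with the limit taken over closed intervals that
    contain p but need not be centred at it. *)
Definition density_one {R : realType} (p : R) (E : set R) : Prop :=
  forall e : R, 0 < e -> exists2 d : R, 0 < d &
    forall J : set R, closed_interval J -> J p -> (0 < mu J < d%:E)%E ->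
      ((1 - e)%:E * mu J <= mu (J `&` E))%E.

Section ideal_density.
Context {R : realType} (I : set (set posnat)).
Hypotheses (I_ideal : is_ideal I) (I_nontrivial : nontrivial_ideal I)
  (I_admissible : admissible_ideal I).
Implicit Types (p : R) (E : set R) (J : posnat -> set R).

Lemma ideal_set0 : I set0.
Proof. by case: I_ideal => -[A IA] _ /(_ set0 A); apply. Qed.

Lemma ideal_finite_val (N : nat) : I [set k | (val k <= N)%N].
Proof.
case: I_ideal => _ IU Isub; elim: N => [|N IN].
  by apply: Isub ideal_set0 => -[[]].
apply: Isub (IU _ _ IN (I_admissible (exist _ N.+1 isT))) => k /=.
by rewrite leq_eqVlt => /orP[/eqP kN|]; [right; exact: val_inj|left].
Qed.

Lemma relative_measure_le1 E J k : relative_measure E J k <= 1.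
Proof.
rewrite /relative_measure.
have JE : (mu (J k `&` E) <= mu (J k))%E by exact: le_outer_measure.
change (fine (mu (J k `&` E)) / fine (mu (J k)) <= 1).
have [->|Jfin] := eqVneq (mu (J k)) +oo%E; first by rewrite /= invr0 mulr0.
have Jf : (mu (J k) \is a fin_num).
  by rewrite ge0_fin_numE ?outer_measure_ge0// ltey.
have JEf : (mu (J k `&` E) \is a fin_num).
  by rewrite ge0_fin_numE ?outer_measure_ge0// (le_lt_trans JE)// ltey.
have J0 : 0 <= fine (mu (J k)) by rewrite fine_ge0// outer_measure_ge0.
have [->|Jn0] := eqVneq (fine (mu (J k))) 0; first by rewrite invr0 mulr0.
by rewrite ler_pdivrMr ?lt0r ?Jn0// mul1r fine_le.
Qed.

Lemma ideal_limsup_le1 E J : (ideal_limsup I (relative_measure E J) <= 1)%E.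
Proof.
apply: ge_ereal_sup => _ [b /= nIb <-]; rewrite lee_fin leNgt; apply/negP => b1.
apply: nIb; rewrite (_ : [set _ | _] = set0); first exact: ideal_set0.
apply/seteqP; split => // k /= /(lt_trans b1).
by rewrite ltNge relative_measure_le1.
Qed.

Lemma ideal_liminf_le1 E J : (ideal_liminf I (relative_measure E J) <= 1)%E.
Proof.
apply/lee_addgt0Pr => e e0; apply: ge_ereal_inf; exists (1 + e)%:E => //=.
exists (1 + e) => //; rewrite (_ : [set _ | _] = setT); first by case: I_nontrivial.
apply/seteqP; split => // k _ /=.
by rewrite (le_lt_trans (relative_measure_le1 _ _ _))// ltrDl.
Qed.

(** If {x > 1 - e} is in the ideal, then {x < 1 - e / 2} is not, since the two
    sets cover all indices; so the lower limit would be below 1. *)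
Lemma ideal_limsup_ge1 E J :
  (1 <= ideal_liminf I (relative_measure E J))%E ->
  (1 <= ideal_limsup I (relative_measure E J))%E.
Proof.
move=> inf1; apply/lee_addgt0Pr => e e0.
rewrite -leeBlDr//; apply: le_ereal_sup_tmp; exists (1 - e)%:E => //=.
exists (1 - e) => // Ib; case: I_ideal => _ IU Isub.
have Ia : I [set k | relative_measure E J k < 1 - e / 2].
  apply: contrapT => nIa.
  suff : (1 <= (1 - e / 2)%:E)%E by rewrite lee_fin; lra.
  apply: le_trans inf1 _; apply: ge_ereal_inf; exists (1 - e / 2)%:E => //.
  by exists (1 - e / 2).
case: I_nontrivial => _; apply; apply: Isub (IU _ _ Ib Ia) => k _ /=.
by case: (ltP (1 - e)) => [|h]; [left|right; lra].
Qed.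

(** Without a shrinking sequence at p the upper density would be the supremum of
    the empty set, -oo. *)
Lemma ideal_shrinking_ex p : exists J, ideal_shrinking I p J.
Proof.
pose w (k : posnat) : R := (val k).+1%:R^-1.
have w0 k : 0 < w k by rewrite invr_gt0 ltr0n.
exists (fun k => [set` `[p, p + w k]]); split => [k|k|].
- by split; [exact: interval_is_interval|exact: interval_closed].
- by rewrite /= in_itv /= lexx lerDl ltW.
- rewrite /dual_filter /= (_ : ~` _ = set0); first exact: ideal_set0.
  apply/seteqP; split => // k /=; apply.
  rewrite -[completed_lebesgue_measure _]/(mu `[p, (p + w k)%R]).
  rewrite mu_itvcc ?lerDl ?ltW// addrAC subrr add0r !lte_fin w0/=.
  by rewrite ltf_pV2 ?posrE ?ltr0n ?ltr_nat//; exact: (valP k).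
Qed.

(** Left to right, a failure of ordinary density 1 gives bad intervals J_n of
    length below 1/n for every n, hence a single shrinking sequence whose
    relative measures all stay below 1 - e.  Right to left, relative measures
    below a < 1 occur only at indices n for which the measure of J_n is not
    strictly between 0 and 1/n, and at the finitely many n for which 1/n is not
    below the length d that ordinary density provides. *)
Lemma has_ideal_density_one p E :
  has_ideal_density I p E 1 <-> density_one p E.
Proof.
split=> [[_ low] e e0|dE].
- apply: contrapT => nd.
  have /choice[J /all_and4[Jci Jp Jmu JE]] : forall k : posnat, exists J : set R,
      [/\ closed_interval J, J p, (0 < mu J < ((val k)%:R^-1 : R)%:E)%E
        & (mu (J `&` E) < (1 - e)%:E * mu J)%E].
    move=> k; apply: contrapT => nJ; apply: nd; exists (val k)%:R^-1.
      by rewrite invr_gt0 ltr0n (valP k).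
    move=> J Jci Jp Jmu; rewrite leNgt; apply/negP => JE; apply: nJ.
    by exists J; split.
  have Jsh : ideal_shrinking I p J.
    split => //; rewrite /dual_filter /= (_ : ~` _ = set0); first exact: ideal_set0.
    by apply/seteqP; split => // k /=; apply; exact: Jmu.
  suff : (lower_ideal_density I p E <= (1 - e)%:E)%E.
    by rewrite low lee_fin; lra.
  apply: ge_ereal_inf; eexists; first by exists J.
  apply: ge_ereal_inf; exists (1 - e)%:E => //; exists (1 - e) => //=.
  rewrite (_ : [set _ | _] = setT); first by case: I_nontrivial.
  apply/seteqP; split => // k _ /=; rewrite /relative_measure.
  change (fine (mu (J k `&` E)) / fine (mu (J k)) < 1 - e).
  have /andP[J0 Jlt] := Jmu k; have := JE k.
  have Jfin : mu (J k) \is a fin_num by exact: fin_num_mu Jlt.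
  have JEfin : mu (J k `&` E) \is a fin_num by exact: fin_num_mu Jlt.
  rewrite ltr_pdivrMr; last by rewrite -lte_fin fineK.
  by rewrite -lte_fin EFinM !fineK.
- have low J : ideal_shrinking I p J ->
      (1 <= ideal_liminf I (relative_measure E J))%E.
    move=> [Jci Jp IJ]; apply: le_ereal_inf_tmp => _ [a /= nIa <-].
    rewrite lee_fin leNgt; apply/negP => a1; apply: nIa.
    have [|d d0 dJ] := dE (1 - a); first by rewrite subr_gt0.
    case: I_ideal => _ IU Isub.
    apply: Isub (IU _ _ IJ (ideal_finite_val (Num.truncn d^-1).+1)) => k /= xa.
    have [/= Jk|] := pselect (0 < completed_lebesgue_measure (J k)
                    < ((val k)%:R^-1 : R)%:E)%E; last by left.
    right; rewrite leqNgt; apply/negP => Nk; move: xa; apply/negP; rewrite -leNgt.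
    have {}Jk : (0 < mu (J k) < d%:E)%E.
      case/andP: Jk => -> /= /lt_le_trans; apply; rewrite lee_fin.
      rewrite -[leRHS]invrK lef_pV2 ?posrE ?invr_gt0 ?ltr0n ?(valP k)//.
      apply: le_trans (ltW (truncnS_gt _)) _; rewrite ler_nat; exact: ltnW.
    have := dJ _ (Jci k) (Jp k) Jk; rewrite subKr.
    case/andP: Jk => J0 Jlt.
    have Jfin : mu (J k) \is a fin_num by exact: fin_num_mu Jlt.
    have JEfin : mu (J k `&` E) \is a fin_num by exact: fin_num_mu Jlt.
    rewrite /relative_measure => h.
    change (a <= fine (mu (J k `&` E)) / fine (mu (J k))).
    rewrite ler_pdivlMr; last by rewrite -lte_fin fineK.
    by rewrite -lee_fin EFinM !fineK.
  have [J0 J0sh] := ideal_shrinking_ex p.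
  split; apply/eqP; rewrite eq_le; apply/andP; split.
  + by apply: ge_ereal_sup => _ [J _ <-]; exact: ideal_limsup_le1.
  + apply: le_ereal_sup_tmp; eexists; first by exists J0.
    exact/ideal_limsup_ge1/low.
  + apply: ge_ereal_inf; eexists; first by exists J0.
    exact: ideal_liminf_le1.
  + by apply: le_ereal_inf_tmp => _ [J /low ? <-].
Qed.

End ideal_density.

(** * A closed subset that loses little measure near Z *)

Lemma open_lebesgue_measurable (R : realType) (A : set R) :
  open A -> lebesgue_measurable A.
Proof. by move=> oA; apply: sub_caratheodory; exact: open_measurable. Qed.

Lemma outer_approx_open (R : realType) (C : set R) (e : R) :
  lebesgue_measurable C -> (mu C < +oo)%E -> 0 < e ->
  exists V : set R, [/\ open V, C `<=` V & (mu (V `\` C) <= e%:E)%E].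
Proof.
move=> mC Cfin e0; have [V [oV CV VC]] := outer_measure_open_le C e0.
exists V; split => //.
have Cf : mu C \is a fin_num by rewrite ge0_fin_numE ?outer_measure_ge0.
rewrite -(leeD2lE _ _ Cf); apply: le_trans VC.
by rewrite -[leRHS]/(mu V) [mu V]mC (setIidr CV) setDE.
Qed.

(** The complement of H is exhausted by bounded pieces at distance at least
    1/(k+1) from Z; the k-th one is covered by an open set at the same distance
    from Z whose excess is at most 2^-(k+1) / (k+1)^2.  An interval J that meets
    Z and has measure at most r meets the k-th cover only if 1/(k+1) <= r, and
    then the excess is at most r^2 / 2^(k+1); these bounds sum to r^2. *)
Lemma closed_subset_quadratic_loss (R : realType) (H Z : set R) :
  lebesgue_measurable H -> closed Z -> Z `<=` H ->
  exists F : set R, [/\ closed F, Z `<=` F, F `<=` H &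
    forall (J : set R) (z r : R), is_interval J -> J z -> Z z ->
      (mu J <= r%:E)%E -> (mu (J `&` H) <= mu (J `&` F) + (r ^+ 2)%:E)%E].
Proof.
move=> mH cZ ZH.
(* The ball makes the measure of the pieces finite, as the approximation from
   outside requires. *)
pose W k : set R :=
  [set x | forall z, Z z -> k.+1%:R^-1 <= `|x - z|]° `&` ball 0 k.+1%:R.
have oW k : open (W k) by apply: openI; [exact: open_interior|exact: ball_open].
have WZ k x z : W k x -> Z z -> k.+1%:R^-1 <= `|x - z|.
  by move=> [/interior_subset /(_ z)].
have WC x : ~ Z x -> exists k, W k x.
  move=> nZx; have /nbhs_ballP[r /= r0 rZ] : nbhs x (~` Z).
    by apply: open_nbhs_nbhs; split => //; exact: closed_openC.
  pose k := (Num.truncn (Num.max (2 / r) `|x|)).+1.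
  have kM : Num.max (2 / r) `|x| < k%:R by exact: truncnS_gt.
  move: kM; rewrite gt_max => /andP[kr kx].
  have k1 : k%:R < k.+1%:R :> R by rewrite ltr_nat.
  have kr2 : k.+1%:R^-1 < r / 2.
    rewrite -[ltRHS]invrK ltf_pV2 ?posrE ?invr_gt0 ?divr_gt0//.
    by rewrite invf_div (lt_trans kr).
  exists k; split; last by rewrite -ball_normE /= sub0r normrN (lt_trans kx).
  apply/nbhs_ballP; exists (r / 2); first by rewrite /= divr_gt0.
  move=> y; rewrite -ball_normE /= => xy z Zz; rewrite leNgt; apply/negP => yz.
  apply: (rZ z) => //; rewrite -ball_normE /=.
  rewrite -(subrKA y) (le_lt_trans (ler_normD _ _))//.
  by rewrite (splitr r) ltrD// (lt_trans yz).
pose e k : R := (k.+1%:R^-1) ^+ 2 / (2 ^ k.+1)%:R.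
have e0 k : 0 < e k.
  by rewrite divr_gt0 ?exprn_gt0 ?invr_gt0 ?ltr0n ?expn_gt0.
have /choice[V /all_and3[oV CV VC]] : forall k, exists V : set R,
    [/\ open V, ~` H `&` W k `<=` V & (mu (V `\` (~` H `&` W k)) <= (e k)%:E)%E].
  move=> k; apply: outer_approx_open => //.
    apply: measurableI; first exact: measurableC.
    exact: open_lebesgue_measurable.
  apply: (@le_lt_trans _ _ (mu `[- (k.+1%:R), k.+1%:R])).
    apply: le_outer_measure => x [_ [_]]; rewrite -ball_normE /= sub0r normrN.
    by rewrite in_itv /= -ler_norml => /ltW.
  by rewrite mu_itvcc ?ltry// ge0_cp//.
pose G := \bigcup_k (V k `&` W k).
exists (~` G); split.
- by apply: open_closedC; apply: bigcup_open => k _; exact: openI.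
- move=> z Zz [k _ [_ /WZ /(_ Zz)]]; rewrite subrr normr0.
  by rewrite leNgt invr_gt0 ltr0n.
- move=> x nGx; apply: contrapT => nHx; apply: nGx.
  have [k Wk] := WC x (fun Zx => nHx (ZH _ Zx)).
  by exists k => //; split => //; exact: CV.
- move=> J z r Jint Jz Zz Jr.
  have JG : (mu (\bigcup_k (J `&` H `&` (V k `&` W k))) <= (r ^+ 2)%:E)%E.
    apply: le_trans (outer_measure_sigma_subadditive _ _) _.
    apply: le_trans _ (@epsilon_trick0 _ (r ^+ 2) xpredT (sqr_ge0 _)).
    apply: lee_nneseries => [k _ _|k _]; first exact: outer_measure_ge0.
    have [rk|rk] := leP k.+1%:R^-1 r.
      apply: (@le_trans _ _ (e k)%:E).
        apply: le_trans _ (VC k); apply: le_outer_measure => x [[_ Hx] [Vx _]].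
        by split => // -[].
      rewrite lee_fin /e ler_pM2r ?invr_gt0 ?ltr0n ?expn_gt0//.
      by rewrite ler_sqr ?nnegrE ?invr_ge0 ?ler0n// (le_trans _ rk) ?invr_ge0.
    rewrite (_ : _ `&` _ = set0).
      by rewrite outer_measure0 lee_fin divr_ge0 ?sqr_ge0.
    apply/seteqP; split => // x [[Jx _] [_ /WZ /(_ Zz) kxz]].
    have := le_trans (interval_dist_le_mu _ _ _ _ Jint Jx Jz) Jr.
    by rewrite lee_fin => /(le_trans kxz); rewrite leNgt rk.
  apply: (le_trans _ (leeD2l _ JG)).
  apply: le_trans _ (outer_measureU2 _ _ _).
  apply: le_outer_measure => x [Jx Hx].
  by have [[k _ ?]|nGx] := pselect (G x); [right; exists k|left].
Qed.

(** * The support of Lebesgue measure on a closed set *)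

(** The relatively open null parts of F are covered by those among countably many
    rational intervals, so removing all of them removes a null set. *)
Lemma measure_support (R : realType) (F : set R) : closed F ->
  exists P : set R, [/\ closed P, P `<=` F, mu (F `\` P) = 0 &
    forall U, open U -> U `&` P !=set0 -> (0 < mu (U `&` P))%E].
Proof.
move=> cF.
pose B (q : rat * rat) : set R := [set` `]ratr q.1, ratr q.2[].
pose null := [set q | mu (F `&` B q) = 0%E].
pose O := \bigcup_(q in null) B q.
have FO : mu (F `&` O) = 0%E.
  apply/eqP; rewrite eq_le outer_measure_ge0 andbT.
  (* Subadditivity holds for sequences, so the pairs of rationals are numbered. *)
  pose S n : set R := if unpickle n is Some q then
    (if `[< null q >] then F `&` B q else set0) else set0.
  apply: (@le_trans _ _ (mu (\bigcup_n S n))).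
    apply: le_outer_measure => x [Fx [q nq Bqx]].
    exists (pickle q); first exact: Logic.I.
    by rewrite /S pickleK asboolT.
  apply: le_trans (outer_measure_sigma_subadditive _ _) _.
  rewrite eseries0// => n _ _; rewrite /S; case: unpickle => [q|]; last first.
    exact: outer_measure0.
  by case: asboolP => [//|_]; exact: outer_measure0.
exists (F `\` O); split.
- apply: closedI => //; apply: open_closedC; apply: bigcup_open => q _.
  exact: interval_open.
- exact: subDsetl.
- by rewrite setDD.
- move=> U oU [x [Ux [Fx nOx]]]; rewrite lt0e outer_measure_ge0 andbT.
  apply/eqP => UP0; apply: nOx.
  have /nbhs_ballP[r /= r0 rU] : nbhs x U by exact: open_nbhs_nbhs.
  have [a /itvP axr] := rat_in_itvoo (ltac:(lra) : x - r < x).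
  have [b /itvP bxr] := rat_in_itvoo (ltac:(lra) : x < x + r).
  have Bx : B (a, b) x by rewrite /B /= in_itv /= axr bxr.
  exists (a, b) => //.
  have BU : B (a, b) `<=` U.
    move=> y; rewrite /B /= in_itv /= => /andP[ay yb]; apply: rU.
    rewrite -ball_normE /= ltr_distlC (lt_trans _ ay) ?axr// (lt_trans yb) ?bxr//.
  apply/eqP; rewrite eq_le outer_measure_ge0 andbT -[leRHS]adde0 -{1}UP0 -FO.
  apply: le_trans _ (outer_measureU2 _ _ _); apply: le_outer_measure => y [Fy By].
  by have [Oy|nOy] := pselect (O y); [right|left; split => //; exact: BU].
Qed.

(** * Density one under small changes of the set *)

(** The loss |J|^2 is at most e / 2 * |J| as soon as |J| <= e / 2. *)
Lemma density_one_perturb (R : realType) (p : R) (H P : set R) :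
  (forall (J : set R) (r : R), closed_interval J -> J p -> (mu J <= r%:E)%E ->
    (mu (J `&` H) <= mu (J `&` P) + (r ^+ 2)%:E)%E) ->
  density_one p H -> density_one p P.
Proof.
move=> HP dH e e0; have [|d d0 dJ] := dH (e / 2); first by rewrite divr_gt0.
exists (Num.min d (e / 2)); first by rewrite lt_min d0 divr_gt0.
move=> J Jci Jp /andP[J0]; rewrite EFin_min lt_min => /andP[Jd Je].
have Jfin : mu J \is a fin_num by exact: fin_num_mu Jd.
have JPfin : mu (J `&` P) \is a fin_num by exact: fin_num_mu Jd.
have {dJ} := dJ J Jci Jp; rewrite J0 Jd => /(_ isT) dJ.
have := HP J (fine (mu J)) Jci Jp; rewrite fineK// lexx => /(_ isT) {}HP.
move: (le_trans dJ HP) J0 Je.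
rewrite -(fineK Jfin) -(fineK JPfin) -!EFinM -EFinD !lee_fin !lte_fin expr2.
rewrite /=; move: (fine _) (fine _) => q m h m0 me.
have : m * m <= m * (e / 2) by rewrite ler_pM2l// ltW.
lra.
Qed.

(** A closed P that misses p also misses a one-sided interval [p, p + w] with w
    arbitrarily small. *)
Lemma density_one_closed (R : realType) (p : R) (P : set R) :
  closed P -> density_one p P -> P p.
Proof.
move=> cP dP; apply: contrapT => nPp.
have /nbhs_ballP[r /= r0 rP] : nbhs p (~` P).
  by apply: open_nbhs_nbhs; split => //; exact: closed_openC.
have [|d d0 dJ] := dP (1 / 2); first by rewrite divr_gt0.
pose w := Num.min d r / 2.
have m0 : 0 < Num.min d r by rewrite lt_min d0 r0.
have [wd wr] : w < d /\ w < r.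
  have : Num.min d r <= d /\ Num.min d r <= r by rewrite !ge_min !lexx orbT.
  by rewrite /w => -[]; lra.
have w0 : 0 < w by rewrite divr_gt0.
have := dJ [set` `[p, p + w]].
rewrite mu_itvcc ?lerDl ?(ltW w0)// (addrC p) addrK !lte_fin w0 wd.
rewrite (_ : _ `&` P = set0) ?outer_measure0; last first.
  apply/seteqP; split => // y [] /=; rewrite in_itv /= => /andP[py yw] Py.
  apply: (rP y) => //; rewrite -ball_normE /= distrC ger0_norm ?subr_ge0//.
  lra.
rewrite -EFinM lee_fin => h.
suff : (1 - 1 / 2) * w <= 0 by lra.
apply: h => //; last by rewrite /= in_itv /= lexx lerDr ltW.
by split; [exact: interval_is_interval|exact: interval_closed].
Qed.

Theorem theorem6p9 (R : realType) (I : set (set posnat))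
    (I_ideal : is_ideal I) (I_nontrivial : nontrivial_ideal I)
    (I_admissible : admissible_ideal I)
    (H : set R) (H_measurable : lebesgue_measurable H) :
  forall Z : set R, closed Z -> Z `<=` H ->
    (forall x, Z x -> has_ideal_density I x H 1) ->
    exists P : set R,
      [/\ perfect_set P, Z `<=` P, P `<=` H
        & forall x, Z x -> has_ideal_density I x P 1].
Proof.
move=> Z cZ ZH dH.
have [F [cF ZF FH HF]] := closed_subset_quadratic_loss _ _ _ H_measurable cZ ZH.
have [P [cP PF FP0 Ppos]] := measure_support _ _ cF.
have dP z : Z z -> density_one z P.
  move=> Zz; move: (dH z Zz).
  move/(has_ideal_density_one _ I_ideal I_nontrivial I_admissible).
  apply: density_one_perturb => J r [Jint _] Jz Jr.
  apply: le_trans (HF J z r Jint Jz Zz Jr) _; rewrite leeD2r//.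
  rewrite -[leRHS]adde0 -FP0; apply: le_trans _ (outer_measureU2 _ _ _).
  apply: le_outer_measure => x [Jx Fx].
  by have [Px|nPx] := pselect (P x); [left|right].
exists P; split.
- split=> //; apply/seteqP; split=> [x /subset_limit_point|x Px U].
    by move/closure_id : cP => {2}->.
  rewrite nbhsE /= => -[V [oV Vx] VU].
  have : (0 < mu (V `&` P))%E by apply: Ppos => //; exists x.
  apply: contraPP => /forallNP noy; apply/negP; rewrite -leNgt.
  apply: (@le_trans _ _ (mu `[x, x])); last by rewrite mu_itvcc// subrr.
  apply: le_outer_measure => y [Vy Py] /=; rewrite in_itv /=.
  have [->|yx] := eqVneq y x; first by rewrite lexx.
  by exfalso; apply: (noy y); split => //; exact: VU.
- by move=> z /dP; exact: density_one_closed.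
- exact: subset_trans PF FH.
- move=> z /dP dz.
  exact/(has_ideal_density_one _ I_ideal I_nontrivial I_admissible).
Qed.
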